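(* Let $G$ be a non-discrete lcsc group and $M$ a local $G$-space. Then $\mathrm{vol}_M$ has no atoms.
   Context: An lcsc group is a locally compact second countable group; fix a Haar measure $\lambda$ on $G$. A local $G$-space is an lcsc space $M$ with a continuous map $\alpha:\mathrm{dom}(\alpha)\to M$, $\mathrm{dom}(\alpha)\subset G\times M$ open, written $g.p=\alpha(g,p)$, such that for all $p\in M$: (1) $(1_G,p)\in\mathrm{dom}(\alpha)$ and $1_G.p=p$; (2) if $(g,p)\in\mathrm{dom}(\alpha)$ then $(g^{-1},g.p)\in\mathrm{dom}(\alpha)$ and $g^{-1}.(g.p)=p$; (3) if $(h,p),(g,h.p),(gh,p)\in\mathrm{dom}(\alpha)$ then $gh.p=g.(h.p)$; (4) there is an open neighborhood $O_p$ of $1_G$ with $O_p\times\{p\}\subset\mathrm{dom}(\alpha)$ such that $g\mapsto g.p$ is a homeomorphism of $O_p$ onto an open neighborhood of $p$. A chart centered at $p$ is a homeomorphism $f_p$ from an open neighborhood of $p$ in $M$ onto an open neighborhood $\mathrm{rng}(f_p)$ of $1_G$ with $f_p(g.p)=g$ for all $g\in\mathrm{rng}(f_p)$. The canonical measure $\mathrm{vol}_M$ is the unique Radon measure on $M$ with $\mathrm{vol}_M(K)=\lambda(f_p(K))$ for every chart $f_p$ and Borel $K\subset\mathrm{dom}(f_p)$ (its existence and uniqueness is a known fact). *)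

(* Defs.v *)
From HB Require Import structures.
From mathcomp Require Import all_boot all_order all_algebra.
From mathcomp Require Import all_classical all_reals all_analysis.
Set Implicit Arguments. Unset Strict Implicit. Unset Printing Implicit Defensive.
Import Order.TTheory GRing.Theory Num.Theory.
Local Open Scope classical_set_scope.
Local Open Scope ring_scope.
Local Open Scope ereal_scope.

Notation borel T := (g_sigma_algebraType (@open T)).

Definition borel_set (T : ptopologicalType) (A : set T) : Prop :=
  @measurable _ (borel T) A.

Definition lcsc (T : ptopologicalType) : Prop :=
  [/\ locally_compact [set: T], @second_countable T & hausdorff_space T].

Definition radon (R : realType) (T : ptopologicalType)
    (mu : {measure set (borel T) -> \bar R}) : Prop :=
  [/\ (forall K : set T, compact K -> mu K < +oo),
      (forall A : set T, borel_set A ->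
         mu A = ereal_inf [set mu U | U in [set U : set T | open U /\ A `<=` U]])
    & (forall U : set T, open U ->
         mu U = ereal_sup [set mu K | K in [set K : set T | compact K /\ K `<=` U]])].

Definition topological_group (G : ptopologicalType)
    (mul : G -> G -> G) (inv : G -> G) (one : G) : Prop :=
  [/\ (forall x y z, mul x (mul y z) = mul (mul x y) z),
      (forall x, mul one x = x /\ mul x one = x),
      (forall x, mul (inv x) x = one /\ mul x (inv x) = one),
      continuous (fun q : G * G => mul q.1 q.2)
    & continuous inv].

Definition lcsc_group (G : ptopologicalType)
    (mul : G -> G -> G) (inv : G -> G) (one : G) : Prop :=
  topological_group mul inv one /\ lcsc G.

Definition non_discrete (T : ptopologicalType) : Prop :=
  ~ (forall A : set T, open A).

Definition haar_measure (R : realType) (G : ptopologicalType)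
    (mul : G -> G -> G) (lambda : {measure set (borel G) -> \bar R}) : Prop :=
  [/\ radon lambda,
      (forall (g : G) (A : set G), borel_set A ->
          lambda [set mul g x | x in A] = lambda A)
    & lambda [set: G] <> 0].

Definition homeo_on (X Y : topologicalType) (f : X -> Y) (U : set X) (V : set Y)
    : Prop :=
  [/\ f @` U = V, {in U &, injective f}, {within U, continuous f}
    & exists h : Y -> X,
        [/\ {within V, continuous h},
            (forall x, U x -> h (f x) = x)
          & (forall y, V y -> f (h y) = y)]].

Definition local_G_space (G M : ptopologicalType)
    (mul : G -> G -> G) (inv : G -> G) (one : G)
    (dom : set (G * M)) (alpha : G -> M -> M) : Prop :=
  [/\ lcsc M, open dom
    & {within dom, continuous (fun q : G * M => alpha q.1 q.2)}] /\
  [/\ (forall p, dom (one, p) /\ alpha one p = p),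
      (forall g p, dom (g, p) ->
          dom (inv g, alpha g p) /\ alpha (inv g) (alpha g p) = p),
      (forall g h p, dom (h, p) -> dom (g, alpha h p) -> dom (mul g h, p) ->
          alpha (mul g h) p = alpha g (alpha h p))
    & (forall p, exists O : set G,
          [/\ open O, O one, (forall g, O g -> dom (g, p)),
              open ((fun g => alpha g p) @` O)
            & homeo_on (fun g => alpha g p) O ((fun g => alpha g p) @` O)])].

Definition chart (G M : ptopologicalType) (one : G)
    (dom : set (G * M)) (alpha : G -> M -> M)
    (p : M) (D : set M) (f : M -> G) : Prop :=
  [/\ open D, D p, open (f @` D), (f @` D) one & homeo_on f D (f @` D)] /\
  (forall g, (f @` D) g -> [/\ dom (g, p), D (alpha g p) & f (alpha g p) = g]).

Definition canonical_measure (R : realType) (G M : ptopologicalType) (one : G)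
    (lambda : {measure set (borel G) -> \bar R})
    (dom : set (G * M)) (alpha : G -> M -> M)
    (vol : {measure set (borel M) -> \bar R}) : Prop :=
  radon vol /\
  (forall p D f, chart one dom alpha p D f ->
     forall K : set M, borel_set K -> K `<=` D -> vol K = lambda (f @` K)).

(* Main.v *)
Require Import Defs.
From HB Require Import structures.
From mathcomp Require Import all_boot all_order all_algebra.
From mathcomp Require Import all_classical all_reals all_analysis.
Set Implicit Arguments. Unset Strict Implicit. Unset Printing Implicit Defensive.
Import Order.TTheory GRing.Theory Num.Theory.
Local Open Scope classical_set_scope.
Local Open Scope ring_scope.
Local Open Scope ereal_scope.

(* In a chart centered at p, a point of M has the Haar measure of a point of
   G.  By left invariance all points of G have the same Haar measure c, and a
   compact neighbourhood of the identity has finite measure; since G is not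
   discrete that neighbourhood is infinite, so it contains n points for every
   n and n c stays bounded, forcing c = 0. *)

Lemma borel_set_closed (T : ptopologicalType) (A : set T) :
  closed A -> borel_set A.
Proof.
move=> clA; rewrite /borel_set -[A]setCK; apply: measurableC.
by apply: sub_gen_smallest; exact: closed_openC.
Qed.

Lemma borel_set1 (T : ptopologicalType) :
  hausdorff_space T -> forall x : T, borel_set [set x].
Proof.
move=> hT x; apply: borel_set_closed.
exact: accessible_closed_set1 (hausdorff_accessible hT) x.
Qed.

Lemma not_nbhs_set1_infinite (T : topologicalType) (x : T) (U : set T) :
  accessible_space T -> ~ nbhs x [set x] -> nbhs x U -> infinite_set U.
Proof.
move=> acT x_nisol Ux Ufin; apply: x_nisol.
have clUx : closed (U `\ x).
  by apply: (proj1 (@accessible_finite_set_closed T) acT); exact: finite_setD.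
have nbhs_notUx : nbhs x (~` (U `\ x)).
  by apply: open_nbhs_nbhs; split; [exact: closed_openC | move=> [_]; apply].
apply: filterS (filterI Ux nbhs_notUx) => y [Uy notUxy].
by apply: contra_notP notUxy => yx; split.
Qed.

Lemma isolated_one_discrete (G : ptopologicalType)
    (mul : G -> G -> G) (inv : G -> G) (one : G) :
  topological_group mul inv one -> nbhs one [set one] ->
  forall A : set G, open A.
Proof.
case=> mulA mul1 mulV mul_cont _ one_isol A; rewrite openE => x Ax.
suff : nbhs x [set x] by apply: filterS => _ ->.
have translate_cvg : (fun y => mul (inv x) y) @ x --> one.
  rewrite -(proj1 (mulV x)).
  apply: (@continuous2_cvg _ _ _ _ _ _ (fun _ => inv x) id mul).
  - exact: (mul_cont (inv x, x)).
  - exact: cvg_cst.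
  - exact: cvg_id.
have : nbhs x ((fun y => mul (inv x) y) @^-1` [set one]) :=
  translate_cvg _ one_isol.
apply: filterS => y /= xy1.
by rewrite -(proj1 (mul1 y)) -(proj2 (mulV x)) -mulA xy1 (proj2 (mul1 x)).
Qed.

Lemma natmul_bounded_eq0 (R : realType) (c u : \bar R) :
  0 <= c -> u < +oo -> (forall n, c *+ n <= u) -> c = 0.
Proof.
move=> c_ge0 u_fin c_le.
have [c_fin u_ge0] : c < +oo /\ 0 <= u.
  by split; [apply: le_lt_trans (c_le 1%N) u_fin | apply: le_trans (c_le 0%N)].
move: c_ge0 c_fin u_ge0 u_fin c_le; case: c => [c| |] //; case: u => [u| |] //.
rewrite !lee_fin => c_ge0 _ u_ge0 _ c_le; congr (_%:E).
apply/eqP; rewrite eq_le c_ge0 andbT leNgt; apply/negP => c_gt0.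
have := archi_boundP (divr_ge0 u_ge0 (ltW c_gt0)).
rewrite ltr_pdivrMr // mulr_natl => u_lt.
by have := c_le (Num.Def.archi_bound (u / c)); rewrite -EFin_natmul lee_fin leNgt u_lt.
Qed.

Lemma measure_set1_cst_eq0 d (T : measurableType d) (R : realType)
    (mu : {measure set T -> \bar R}) (U : set T) (c : \bar R) :
  (forall x : T, measurable [set x]) -> measurable U -> infinite_set U ->
  mu U < +oo -> (forall x, U x -> mu [set x] = c) -> c = 0.
Proof.
move=> mset1 mU /infiniteP/pcard_leP/injfunPex [f fU finj] muU_fin muU1.
have c_ge0 : 0 <= c by rewrite -(muU1 (f 0%N)) //; apply: fU.
apply: natmul_bounded_eq0 c_ge0 muU_fin _ => n.
have finite_union_sub : \big[setU/set0]_(i < n) [set f i] `<=` U.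
  apply: (big_ind (fun X => X `<=` U)) => //.
    by move=> A B AU BU x [/AU|/BU].
  by move=> i _ x ->; apply: fU.
apply: (@le_trans _ _ (mu (\big[setU/set0]_(i < n) [set f i]))).
  rewrite measure_bigsetU_ord_cond => [| i _ // | i j _ _ [x [/= -> fij]]].
  - rewrite (eq_bigr (fun _ => c)) ?sumr_const ?card_ord // => i _.
    by apply/muU1/fU.
  - by apply: val_inj; apply: finj; rewrite ?inE.
by apply: le_measure; rewrite ?inE //; apply: bigsetU_measurable.
Qed.

Lemma haar_measure_set1 (R : realType) (G : ptopologicalType)
    (mul : G -> G -> G) (inv : G -> G) (one : G)
    (lambda : {measure set (borel G) -> \bar R}) :
  lcsc_group mul inv one -> non_discrete G -> haar_measure mul lambda ->
  forall g : G, lambda [set g] = 0.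
Proof.
case=> Htg [Glc _ Ghs] Gnd [[lambda_cpt _ _] lambda_inv _].
have lambda_set1 g : lambda [set g] = lambda [set one].
  rewrite -(lambda_inv g _ (borel_set1 Ghs one)) image_set1.
  by case: Htg => _ mul1 _ _ _; rewrite (proj2 (mul1 g)).
have one_nisol : ~ nbhs one [set one].
  by move=> one_isol; apply: Gnd; exact: isolated_one_discrete Htg one_isol.
have [U] := Glc one I; rewrite withinET => Uone [cU clU] g.
rewrite lambda_set1; apply: (@measure_set1_cst_eq0 _ _ _ lambda U).
- exact: borel_set1.
- exact: borel_set_closed.
- exact: not_nbhs_set1_infinite (hausdorff_accessible Ghs) one_nisol Uone.
- exact: lambda_cpt.
- by move=> x _; exact: lambda_set1.
Qed.

Lemma chart_center (G M : ptopologicalType) (one : G) (dom : set (G * M))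
    (alpha : G -> M -> M) (p : M) (D : set M) (f : M -> G) :
  chart one dom alpha p D f -> alpha one p = p -> f p = one.
Proof.
case=> [[_ _ _ Df_one _] chart_orbit] act1.
by case: (chart_orbit one Df_one); rewrite act1.
Qed.

Lemma local_G_space_chart (G M : ptopologicalType)
    (mul : G -> G -> G) (inv : G -> G) (one : G)
    (dom : set (G * M)) (alpha : G -> M -> M) :
  local_G_space mul inv one dom alpha ->
  forall p : M, exists D f, chart one dom alpha p D f.
Proof.
case=> _ [act1 _ _ orbit_homeo] p.
have [W [oW W1 Wdom oV [Vdef orbit_inj orbit_cont [h [hcont hK fK]]]]] :=
  orbit_homeo p.
set V := (fun g => alpha g p) @` W in oV Vdef hcont fK *.
have hV : h @` V = W.
  apply/seteqP; split => [_ [_ [g Wg <-] <-] | g Wg]; first by rewrite hK.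
  by exists (alpha g p); [exists g | exact: hK].
exists V, h; split; first split; rewrite ?hV //.
- by exists one => //; exact: (proj2 (act1 p)).
- split => //; last by exists (fun g => alpha g p).
  by move=> x y /[!inE] Vx Vy hxy; rewrite -(fK x Vx) -(fK y Vy) hxy.
- by move=> g Wg; split; [exact: Wdom | exists g | exact: hK].
Qed.

Theorem lemma6p11 (R : realType) (G : ptopologicalType)
    (mul : G -> G -> G) (inv : G -> G) (one : G)
    (HG : lcsc_group mul inv one) (Hnd : non_discrete G)
    (lambda : {measure set (borel G) -> \bar R}) (Hlambda : haar_measure mul lambda)
    (M : ptopologicalType) (dom : set (G * M)) (alpha : G -> M -> M)
    (HM : local_G_space mul inv one dom alpha)
    (vol : {measure set (borel M) -> \bar R})
    (Hvol : canonical_measure one lambda dom alpha vol) :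
  forall p : M, vol [set p] = 0.
Proof.
move=> p.
case: (HM) => [[[_ _ Mhs] _ _] [act1 _ _ _]].
have [D [f chart_f]] := local_G_space_chart HM p.
case: Hvol => _ vol_chart.
rewrite (vol_chart p D f chart_f [set p]) ?image_set1.
- rewrite (chart_center chart_f (proj2 (act1 p))).
  exact: haar_measure_set1 HG Hnd Hlambda one.
- exact: borel_set1.
- by case: chart_f => [[_ Dp _ _ _] _] x ->.
Qed.
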